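(* Let $X\in\mathbb{R}_{(r_1,\dots,r_{d-1})}^{n_1\times\cdots\times n_d}$ and $A\in\mathbb{R}_{(r_1',\dots,r_{d-1}')}^{n_1\times\cdots\times n_d}$, with orthogonalized factors $X_i',X_i'',\dot X_i$ and invertible matrices $Q_i$ for $X$, and orthogonalized factors $A_i',A_i'',\dot A_i$ and invertible matrices $Q_i'$ for $A$ (see context). Let $f(X)=\frac12\|X-A\|^2$. If $\mathcal P_{T_X\mathbb{R}_{(r_1,\dots,r_{d-1})}^{n_1\times\cdots\times n_d}}\nabla f(X)=0$, then $$\dot X_i=B_i^\top\cdot\dot A_i\cdot C_i,\qquad i=1,\dots,d,$$ where $B_1=I_{n_1}$, $C_d=I_{n_d}$, and $$B_i^\top=\left(X_{1:(i-1)}'\right)^{\mathrm R,\top}\left(A_{1:(i-1)}'\right)^{\mathrm R}\ (i=2,\dots,d),\qquad C_i=\left(A_{(i+1):d}''\right)^{\mathrm L}\left(X_{(i+1):d}''\right)^{\mathrm L,\top}\ (i=1,\dots,d-1).$$ Moreover, $$X_i'=B_i^\top\cdot A_i'\cdot Q_i'C_iQ_i^{-1},\quad i=1,\dots,d-1,\qquad X_i''=Q_{i-1}^{-1}B_i^\top Q_{i-1}'\cdot A_i''\cdot C_i,\quad i=2,\dots,d.$$ Thus, with the matrices $$D_i:=C_iQ_i^{-1}B_{i+1}^\top Q_i',\qquad E_i:=Q_i'C_iQ_i^{-1}B_{i+1}^\top,\qquad i=1,\dots,d-1,$$ one has, for every $i\in\{1,\dots,d\}$, $$X=A_1'E_1\cdots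 A_{i-1}'\cdot E_{i-1}\cdot\dot A_i\cdot D_i\cdot A_{i+1}''\cdots D_{d-1}A_d''.$$ Furthermore, $B_2=Q_1'C_1Q_1^{-1}\in\mathrm{St}(r_1,r_1')$ and $C_{d-1}=\left(Q_{d-1}^{-1}B_d^\top Q_{d-1}'\right)^\top\in\mathrm{St}(r_{d-1},r_{d-1}')$, and for all $i=1,\dots,d-1$ the matrices $D_i$ and $E_i$ have eigenvalue $1$ with multiplicity $r_i$ and their other $r_i'-r_i$ eigenvalues are zero. More specifically, $$B_{i+1}^\top Q_i'C_iQ_i^{-1}=Q_i^{-1}B_{i+1}^\top Q_i'C_i=I_{r_i},$$ and thus the columns of $C_iQ_i^{-1}$ and the rows of $B_{i+1}^\top Q_i'$ are respectively right and left eigenvectors of $D_i$ for eigenvalue $1$, and the columns of $Q_i'C_i$ and the rows of $Q_i^{-1}B_{i+1}^\top$ are respectively right and left eigenvectors of $E_i$ for eigenvalue $1$.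
   Context: Tensors and reshaping. $\langle X,Y\rangle=\langle \mathrm{vec}(X),\mathrm{vec}(Y)\rangle$ is the Euclidean inner product on $\mathbb{R}^{n_1\times\cdots\times n_d}$ and $\|\cdot\|$ the induced norm. All reshapings are column-major. The right unfolding $X^{\mathrm R}$ of a tensor is the matrix whose column index is the last index (all others merged into the row index); the left unfolding $X^{\mathrm L}$ is the matrix whose row index is the first index (all others merged into the column index); the unfoldings of a matrix equal the matrix itself. $X^{\mathrm R,\top}:=(X^{\mathrm R})^\top$, $X^{\mathrm L,\top}:=(X^{\mathrm L})^\top$. The symbol ''$\cdot$'' denotes contraction of the last index of the first factor with the first index of the second. TT-rank. A tensor-train decomposition is $X=X_1\cdots X_d$ with $X_i\in\mathbb{R}^{r_{i-1}\times n_i\times r_i}$, $r_0=r_d=1$; the first and last factors are treated as matrices in $\mathbb{R}^{n_1\times r_1}$ and $\mathbb{R}^{r_{d-1}\times n_d}$. The TT-rank of $X$ is $(\operatorname{rank}X^{<1>},\dots,\operatorname{rank}X^{<d-1>})$, where $X^{<i>}$ is the $n_1\cdots n_i\times n_{i+1}\cdots n_d$ reshaping of $X$. $\mathbb{R}_{(r_1,\dots,r_{d-1})}^{n_1\times\cdots\times n_d}$ is the smooth manifold of tensors of TT-rank exactly $(r_1,\dots,r_{d-1})$. Stiefel manifold: $\mathrm{St}(p,n)=\{U\in\mathbb{R}^{n\times p}: U^\top U=I_p\}$. Orthogonalizations. Orthogonalized factors of $X$ of TT-rank $(r_1,\dots,r_{d-1})$ are tensors $X_i'$ ($i=1,\dots,d-1$),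 $X_i''$ ($i=2,\dots,d$), $\dot X_i$ ($i=1,\dots,d$), all of size $r_{i-1}\times n_i\times r_i$, with $(X_i')^{\mathrm R}\in\mathrm{St}(r_i,r_{i-1}n_i)$, $(X_i'')^{\mathrm L,\top}\in\mathrm{St}(r_{i-1},n_ir_i)$, and for every $i\in\{1,\dots,d\}$ $$X=X_1'\cdots X_{i-1}'\cdot\dot X_i\cdot X_{i+1}''\cdots X_d''.$$ Then there are invertible $Q_i:=(X_i')^{\mathrm R,\top}\dot X_i^{\mathrm R}=\dot X_{i+1}^{\mathrm L}(X_{i+1}'')^{\mathrm L,\top}\in\mathrm{GL}(r_i)$, $i=1,\dots,d-1$, with $\dot X_i^{\mathrm R}=(X_i')^{\mathrm R}Q_i$ and $\dot X_{i+1}^{\mathrm L}=Q_i(X_{i+1}'')^{\mathrm L}$. The factors $A_i',A_i'',\dot A_i$ and matrices $Q_i'\in\mathrm{GL}(r_i')$ are defined in the same way for $A$ with ranks $r_i'$. Write $X_{i:j}':=X_i'\cdots X_j'$ and $X_{i:j}'':=X_i''\cdots X_j''$ (a single factor if $i=j$), and similarly for $A$. Tangent space: $T_X\mathbb{R}_{(r_1,\dots,r_{d-1})}^{n_1\times\cdots\times n_d}$ is the set of all $\sum_{i=1}^d X_{1:(i-1)}'\cdot W_i\cdot X_{(i+1):d}''$ (empty products omitted) with $W_i\in\mathbb{R}^{r_{i-1}\times n_i\times r_i}$ and $W_i^{\mathrm R,\top}(X_i')^{\mathrm R}=0$ for $i=1,\dots,d-1$. $\mathcal P_{T_X\cdots}$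 is the orthogonal projection onto it, and $\nabla f(X)=X-A$ is the Euclidean gradient. *)

(* Defs.v *)
From HB Require Import structures.
From mathcomp Require Import all_boot all_order all_algebra.
From mathcomp Require Import all_classical all_reals all_analysis.

Set Implicit Arguments.
Unset Strict Implicit.
Unset Printing Implicit Defensive.

Import Order.TTheory GRing.Theory Num.Theory.

Local Open Scope ring_scope.

(* Mode sizes n : nat -> nat and ranks r : nat -> nat are used at the indices
   1..d and 0..d respectively; values outside these ranges are irrelevant.    *)

Section Tensors.
Context {R : realType}.
Variables (d : nat) (n : nat -> nat).

(* The k-th mode, 1 <= k <= d, is indexed by the ordinal k.-1 : 'I_d. *)
Definition midx := {dffun forall k : 'I_d, 'I_(n k.+1)}.

Definition tensor := {ffun midx -> R}.

Definition inner (X Y : tensor) : R := \sum_j X j * Y j.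

Definition tnorm (X : tensor) : R := Num.sqrt (inner X X).

Definition half_sqdist (A X : tensor) : R := 2^-1 * tnorm (X - A) ^+ 2.

Definition line (X : tensor) (j : midx) (t : R) : tensor :=
  [ffun k => X k + t * (k == j)%:R].

(* Euclidean gradient: the tensor of all partial derivatives. *)
Definition gradient (f : tensor -> R) (X : tensor) : tensor :=
  [ffun j => derive1 (fun t : R => f (line X j t)) 0].

Definition is_orthogonal_projection (S : tensor -> Prop)
    (P : tensor -> tensor) : Prop :=
  forall Z, S (P Z) /\ (forall V, S V -> inner (Z - P Z) V = 0).

End Tensors.

Arguments tensor R d n : clear implicits.

(* lsize n k = n_1 ... n_k and rsize n k m = n_(k+1) ... n_(k+m). *)
Fixpoint lsize (n : nat -> nat) (k : nat) : nat :=
  if k is k'.+1 then (n k'.+1 * lsize n k')%N else 1.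

Fixpoint rsize (n : nat -> nat) (k m : nat) : nat :=
  if m is m'.+1 then (rsize n k.+1 m' * n k.+1)%N else 1.

(* Column-major position of the entry j, i.e. its position in vec(X). *)
Definition linear_index d n (j : midx d n) : nat :=
  (\sum_(k < d) j k * lsize n k)%N.

(* The reshaping X^<i> of size n_1...n_i x n_(i+1)...n_d: it has the same
   column-major vectorization as X. For i <= d exactly one j is picked. *)
Definition unfolding {R : realType} d n (X : tensor R d n) (i : nat) :
    'M[R]_(lsize n i, rsize n i (d - i)) :=
  \matrix_(p, q)
    if [pick j : midx d n | linear_index j == (q * lsize n i + p)%N] is Some j
    then X j else 0.

Definition has_tt_rank {R : realType} d n (r : nat -> nat)
    (X : tensor R d n) : Prop :=
  forall i, (0 < i < d)%N -> \rank (unfolding X i) = r i.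

Section TensorTrains.
Context {R : realType}.
Variables (n r : nat -> nat).

(* A tensor Y of size r_(i-1) x n_i x r_i is given by its slices: its entry
   (a, j, b) is Y j a b. Thus M . Y . N, for matrices M and N, has the slices
   M *m Y j *m N, and the slices of a product of cores are the products of
   their slices. *)
Definition core (i : nat) := 'I_(n i) -> 'M[R]_(r i.-1, r i).

Definition cores := forall i, core i.

(* Recall that mxvec_index i j : 'I_(m * n) has value i * n + j, so that the
   second argument runs fastest. *)

(* Row index: (first index, second index), the first one running fastest. *)
Definition right_unfolding p m q (Y : 'I_m -> 'M[R]_(p, q)) : 'M[R]_(m * p, q) :=
  (\matrix_(b < q) mxvec (\matrix_(j < m, a < p) Y j a b))^T.

(* Column index: (second index, last index), the second one running fastest. *)
Definition left_unfolding p m q (Y : 'I_m -> 'M[R]_(p, q)) : 'M[R]_(p, q * m) :=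
  \matrix_(a < p) mxvec (\matrix_(b < q, j < m) Y j a b).

(* The row vector (Y_1 ... Y_k)(j_1, ..., j_k, :), a product of slices; here,
   and in left_part and right_part, r 0 = 1 (resp. r d = 1) is intended, and the
   boundary factor const_mx 1 is then the 1 x 1 identity. *)
Fixpoint tt_row (Y : cores) (k : nat) :
    (forall l : 'I_k, 'I_(n l.+1)) -> 'rV[R]_(r k) :=
  match k return (forall l : 'I_k, 'I_(n l.+1)) -> 'rV[R]_(r k) with
  | 0 => fun=> const_mx 1
  | k'.+1 => fun j =>
      tt_row Y (fun l : 'I_k' => j (widen_ord (leqnSn k') l))
        *m Y k'.+1 (j ord_max)
  end.

(* The tensor Y_1 Y_2 ... Y_d; the sum has a single term when r d = 1. *)
Definition tt (d : nat) (Y : cores) : tensor R d n :=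
  [ffun j : midx d n => \sum_b tt_row Y j 0 b].

(* (Y_1 ... Y_k)^R: the right unfolding of Y_1 ... Y_k, seen as a tensor of size
   (n_1 ... n_(k-1)) x n_k x r_k. *)
Fixpoint left_part (Y : cores) (k : nat) : 'M[R]_(lsize n k, r k) :=
  match k return 'M[R]_(lsize n k, r k) with
  | 0 => const_mx 1
  | k'.+1 => right_unfolding (fun j => left_part Y k' *m Y k'.+1 j)
  end.

(* (Y_(k+1) ... Y_(k+m))^L, for r (k + m) = 1. *)
Fixpoint right_part (Y : cores) (k m : nat) : 'M[R]_(r k, rsize n k m) :=
  match m return 'M[R]_(r k, rsize n k m) with
  | 0 => const_mx 1
  | m'.+1 => left_unfolding (fun j => Y k.+1 j *m right_part Y k.+1 m')
  end.

(* The train of cores Y'_1, ..., Y'_(i-1), Y_i, Y''_(i+1), ..., Y''_d. *)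
Definition train (Y' Y Y'' : cores) (i : nat) : cores :=
  fun k => if (k < i)%N then Y' k else if k == i then Y k else Y'' k.

(* U \in St(p, q) *)
Definition stiefel q p (U : 'M[R]_(q, p)) : Prop := U^T *m U = 1%:M.

Definition orthogonalized_factors (d : nat) (X : tensor R d n)
    (X' X'' Xd : cores) : Prop :=
  [/\ forall i, (0 < i < d)%N -> stiefel (right_unfolding (X' i)),
      forall i, (1 < i <= d)%N -> stiefel (left_unfolding (X'' i))^T
    & forall i, (0 < i <= d)%N -> X = tt d (train X' Xd X'' i)].

Definition tangent_space (d : nat) (X' X'' : cores) (V : tensor R d n) : Prop :=
  exists2 W : cores,
    forall i, (0 < i < d)%N ->
      (right_unfolding (W i))^T *m right_unfolding (X' i) = 0
  & V = \sum_(1 <= i < d.+1) tt d (train X' W X'' i).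

Definition Qmx (X' Xd : cores) (i : nat) : 'M[R]_(r i) :=
  (right_unfolding (X' i))^T *m right_unfolding (Xd i).

End TensorTrains.

Arguments core R n r i : clear implicits.
Arguments cores R n r : clear implicits.

Section Comparison.
Context {R : realType}.
Variables (d : nat) (n r r' : nat -> nat).

(* For i = 1 this is the 1 x 1 identity (r 0 = r' 0 = 1). Viewing the first
   core as a 1 x n_1 x r_1 tensor rather than an n_1 x r_1 matrix, multiplication
   by it is the multiplication by I_(n_1) of the first mode of the matrix. *)
Definition Bmx (X' : cores R n r) (A' : cores R n r') (i : nat) :
    'M[R]_(r' i.-1, r i.-1) :=
  ((left_part X' i.-1)^T *m left_part A' i.-1)^T.

(* Similarly, for i = d this is the 1 x 1 identity, in the role of I_(n_d). *)
Definition Cmx (X'' : cores R n r) (A'' : cores R n r') (i : nat) :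
    'M[R]_(r' i, r i) :=
  right_part A'' i (d - i) *m (right_part X'' i (d - i))^T.

End Comparison.

(* Algebraic multiplicities; the eigenvalues are 1 (k times) and 0 (m - k times). *)
Definition eigenvalues_one_zero {R : realType} m (M : 'M[R]_m) (k : nat) : Prop :=
  (k <= m)%N /\ char_poly M = ('X - 1%:P) ^+ k * 'X ^+ (m - k).

Definition right_eigenvector {R : realType} m (M : 'M[R]_m) (a : R)
    (v : 'cV[R]_m) : Prop := v != 0 /\ M *m v = a *: v.

Definition left_eigenvector {R : realType} m (M : 'M[R]_m) (a : R)
    (v : 'rV[R]_m) : Prop := v != 0 /\ v *m M = a *: v.

(* Main.v *)
Require Import Defs.
From HB Require Import structures.
From mathcomp Require Import all_boot all_order all_algebra.
From mathcomp Require Import all_classical all_reals all_analysis.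
From mathcomp Require Import ring.
Import Order.TTheory GRing.Theory Num.Theory.
Local Open Scope ring_scope.

(** The idea. Fixing all cores of a train but the i-th one gives a linear
    parametrization of tensors, W |-> X'_1 ... X'_(i-1) W X''_(i+1) ... X''_d,
    which is an isometry because the outer cores are orthonormal. Pairing such
    a tensor with X, whose i-th center is Xd_i, yields the pairing of W with
    Xd_i; pairing it with A yields the pairing of W with B_i^T Ad_i C_i. So a
    first order condition on X - A is a condition on the residuals
    Z_i = Xd_i - B_i^T Ad_i C_i, one site at a time ([inner_residual]).

    Tangent vectors at site i < d are those W that satisfy the gauge condition
    W^(R,T) X'_i^R = 0, while W is arbitrary at site d. Hence stationarity says
    that Z_d = 0 and that, for i < d, the right unfolding of Z_i lies in the
    column space of X'_i^R; computing the coefficient,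
    Z_i = X'_i (Q_i - B_(i+1)^T Q'_i C_i) ([residual_left_range]). On the other
    hand Z_(i+1) = 0, multiplied by X''_(i+1)^T, says exactly that
    Q_i = B_(i+1)^T Q'_i C_i ([Qmx_of_residual0]). A descending induction
    starting from Z_d = 0 therefore gives Z_i = 0 for all i ([residual0]).

    The identity Q_i = B_(i+1)^T Q'_i C_i with Q_i invertible is the source of
    everything else: D_i and E_i are products U V of rectangular matrices with
    V U = 1, so their spectrum and eigenvectors are those of a projector of
    rank r_i, and in the train of X the matrices B, C can be moved through the
    cores from both ends towards site i ([reconstruction]).

    The invertibility of Q_i comes from the factorization
    X^<i> = (X'_1 ... X'_i)^R Q_i (X''_(i+1) ... X''_d)^L, whose left-hand side
    has rank r_i ([Qmx_unit]). *)

(** * Products U V with V U = 1 *)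

(** In the block matrix K with blocks 'X, U, V, 1, the block V can be eliminated
    with the pivot 1 or with the pivot 'X. Comparing the two determinants gives
    Sylvester's identity 'X^k det('X - U V) = 'X^m det('X - V U). *)
Lemma char_poly_left_inverse (R : idomainType) m k (U : 'M[R]_(m, k))
    (V : 'M[R]_(k, m)) : (k <= m)%N -> V *m U = 1%:M ->
  char_poly (U *m V) = ('X - 1%:P) ^+ k * 'X ^+ (m - k).
Proof.
move=> le_km VU1; pose u := map_mx polyC U; pose v := map_mx polyC V.
have vu1 : v *m u = 1%:M by rewrite -map_mxM VU1 map_mx1.
have XUV : char_poly_mx (U *m V) = 'X%:M - u *m v.
  by rewrite /char_poly_mx map_mxM.
pose K : 'M[{poly R}]_(m + k) := block_mx 'X%:M u v 1%:M.
have KL : \det K = char_poly (U *m V).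
  have: K *m block_mx 1%:M 0 (- v) 1%:M =
      block_mx (char_poly_mx (U *m V)) u 0 1%:M.
    by rewrite mulmx_block !mulmx1 !mul1mx !mulmx0 !mulmxN !add0r addrN XUV.
  move/(congr1 determinant); rewrite det_mulmx det_lblock det_ublock.
  by rewrite !det1 !mulr1.
have: block_mx 1%:M 0 (- v) 'X%:M *m K = block_mx 'X%:M u 0 ('X - 1%:P)%:M.
  rewrite mulmx_block !mul1mx !mul0mx !addr0 !mulmx1 !mulNmx vu1.
  by rewrite mul_mx_scalar mul_scalar_mx addNr addrC -raddfB.
move/(congr1 determinant); rewrite det_mulmx det_lblock det_ublock.
rewrite KL !det_scalar expr1n mul1r -[in RHS](subnK le_km) exprD mulrAC mulrC.
move/(mulIf (expf_neq0 k (negbT (polyX_eq0 R)))) => ->.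
by rewrite mulrC.
Qed.

Section LeftInverse.
Context {R : realType} {m k : nat} {U : 'M[R]_(m, k)} {V : 'M[R]_(k, m)}.
Hypothesis VU1 : V *m U = 1%:M.

Lemma eigenvalues_left_inverse : eigenvalues_one_zero (U *m V) k.
Proof.
have le_km : (k <= m)%N.
  rewrite -[k](mxrank1 R) -VU1.
  by rewrite (leq_trans (mxrankM_maxl _ _)) // rank_leq_col.
by split=> //; apply: char_poly_left_inverse.
Qed.

Lemma col_right_eigenvector (l : 'I_k) : right_eigenvector (U *m V) 1 (col l U).
Proof.
split; last by rewrite scale1r colE !mulmxA -(mulmxA U) VU1 mulmx1.
apply/eqP=> /(congr1 (mulmx V)); rewrite colE mulmxA VU1 mul1mx mulmx0.
by move/matrixP/(_ l 0)/eqP; rewrite !mxE !eqxx oner_eq0.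
Qed.

Lemma row_left_eigenvector (l : 'I_k) : left_eigenvector (U *m V) 1 (row l V).
Proof.
split; last by rewrite scale1r rowE mulmxA -(mulmxA _ V) VU1 mulmx1.
apply/eqP=> /(congr1 (mulmx^~ U)); rewrite rowE -mulmxA VU1 mulmx1 mul0mx.
by move/matrixP/(_ 0 l)/eqP; rewrite !mxE !eqxx oner_eq0.
Qed.

End LeftInverse.

(** * Column-major numbering *)

Lemma mxvec_index_val m n (i : 'I_m) (j : 'I_n) :
  mxvec_index i j = (i * n + j)%N :> nat.
Proof.
have index_pairs (T U : eqType) (s : seq T) (t : seq U) x y :
    x \in s -> y \in t ->
    index (x, y) [seq (a, b) | a <- s, b <- t] =
      (index x s * size t + index y t)%N.
  move=> + yt; elim: s => //= a s IHs.
  have pair_inj : injective (pair a : U -> T * U) by move=> ? ? [].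
  rewrite inE index_cat size_map; case: (eqVneq a x) => [<- _ | nax].
    by rewrite mem_map // yt index_map.
  rewrite /= => xs; rewrite IHs // mulSn addnA ifN //.
  by apply/mapP=> -[b _ [xa _]]; rewrite xa eqxx in nax.
rewrite /mxvec_index /= /enum_rank enum_rank_in.unlock insubdK; last first.
  by rewrite cardE [_ \in _]index_mem mem_enum.
rewrite enumT unlock /= /prod_enum index_pairs ?mem_enum //.
by rewrite !index_enum_ord size_enum_ord.
Qed.

Lemma mixed_radix_ltn n k (j : forall l : 'I_k, 'I_(n l.+1)) :
  (\sum_(l < k) j l * lsize n l < lsize n k)%N.
Proof.
elim: k j => [|k IHk] j; first by rewrite big_ord0.
rewrite big_ord_recr /=.
have := IHk (fun l => j (widen_ord (leqnSn k) l)); set s := (\sum_(_ < k) _)%N.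
move=> lt_s; apply: leq_trans (_ : (j ord_max).+1 * lsize n k <= _)%N.
  by rewrite mulSn ltn_add2r.
by rewrite leq_mul2r ltn_ord orbT.
Qed.

(** The last digit and the remaining ones are the quotient and the remainder of
    the division by lsize n k. *)
Lemma mixed_radix_inj n k (j j' : forall l : 'I_k, 'I_(n l.+1)) :
  (\sum_(l < k) j l * lsize n l = \sum_(l < k) j' l * lsize n l)%N ->
  forall l, j l = j' l.
Proof.
elim: k j j' => [|k IHk] j j' e l; first by case: l.
move: e; rewrite !big_ord_recr /=.
pose w := widen_ord (leqnSn k).
have := mixed_radix_ltn _ _ (fun l => j (w l)).
have := mixed_radix_ltn _ _ (fun l => j' (w l)).
have := IHk (fun l => j (w l)) (fun l => j' (w l)); rewrite /w {w}.
set s := (\sum_(_ < k) _)%N; set s' := (\sum_(_ < k) _)%N => {}IHk lt_s' lt_s.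
rewrite ![(s + _)%N]addnC ![(s' + _)%N]addnC => e.
have L0 : (0 < lsize n k)%N by apply: leq_trans lt_s.
have ss' : s = s'.
  by have := congr1 (modn^~ (lsize n k)) e; rewrite !modnMDl !modn_small.
have jj' : j ord_max = j' ord_max.
  by apply: val_inj; have := congr1 (divn^~ (lsize n k)) e;
     rewrite !divnMDl // !divn_small // !addn0.
have [lk | kl] := ltnP l k; last first.
  have -> // : l = ord_max.
  by apply: val_inj; apply/eqP; rewrite eqn_leq kl -ltnS ltn_ord.
have <- : widen_ord (leqnSn k) (Ordinal lk) = l by apply: val_inj.
exact: IHk.
Qed.

Definition linear_ord {d n} (j : midx d n) : 'I_(lsize n d) :=
  Ordinal (mixed_radix_ltn n d j).

(** Injectivity suffices, since there are as many multi-indices as positions. *)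
Lemma linear_ord_bij d n : bijective (@linear_ord d n).
Proof.
have idx_inj : injective (@linear_ord d n).
  by move=> j j' /(congr1 val) /= /mixed_radix_inj e; apply/ffunP.
apply: inj_card_bij idx_inj _.
rewrite card_ord card_dep_ffun foldrE big_map big_enum /=.
rewrite (eq_bigr (fun k : 'I_d => n k.+1)) => [|k _]; last by rewrite card_ord.
elim: (d) => [|k IHk]; first by rewrite big_ord0.
by rewrite big_ord_recr /= mulnC leq_mul.
Qed.

(** * Unfoldings of cores and of trains *)

Lemma right_unfoldingE {R : realType} {p m q} (Y : 'I_m -> 'M[R]_(p, q)) j a b :
  right_unfolding Y (mxvec_index j a) b = Y j a b.
Proof. by rewrite mxE mxE mxvecE mxE. Qed.

Lemma left_unfoldingE {R : realType} {p m q} (Y : 'I_m -> 'M[R]_(p, q)) a b j :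
  left_unfolding Y a (mxvec_index b j) = Y j a b.
Proof. by rewrite mxE mxvecE mxE. Qed.

Lemma sum_mxvec_index {V : nmodType} m n (F : 'I_(m * n) -> V) :
  \sum_k F k = \sum_i \sum_j F (mxvec_index i j).
Proof.
rewrite (reindex _ (curry_mxvec_bij m n)) /= pair_bigA.
by apply: eq_bigr => -[].
Qed.

Lemma right_unfolding_gram {R : realType} {p m q q'} (Y : 'I_m -> 'M[R]_(p, q))
    (Z : 'I_m -> 'M[R]_(p, q')) :
  (right_unfolding Y)^T *m right_unfolding Z = \sum_j (Y j)^T *m Z j.
Proof.
apply/matrixP=> b c; rewrite mxE sum_mxvec_index summxE; apply: eq_bigr => j _.
by rewrite mxE; apply: eq_bigr => a _; rewrite mxE !right_unfoldingE mxE.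
Qed.

Lemma left_unfolding_gram {R : realType} {p p' m q} (Y : 'I_m -> 'M[R]_(p, q))
    (Z : 'I_m -> 'M[R]_(p', q)) :
  left_unfolding Y *m (left_unfolding Z)^T = \sum_j Y j *m (Z j)^T.
Proof.
apply/matrixP=> b c; rewrite mxE sum_mxvec_index summxE exchange_big /=.
apply: eq_bigr => j _.
rewrite mxE; apply: eq_bigr => a _.
by rewrite left_unfoldingE ![_^T _ c]mxE left_unfoldingE.
Qed.

Lemma right_unfolding_mulr {R : realType} {p m q s} (Y : 'I_m -> 'M[R]_(p, q))
    (M : 'M[R]_(q, s)) :
  right_unfolding (fun j => Y j *m M) = right_unfolding Y *m M.
Proof.
apply/matrixP=> k b; case/mxvec_indexP: k => j a.
rewrite right_unfoldingE !mxE.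
by apply: eq_bigr => c _; rewrite right_unfoldingE.
Qed.

Section Train.
Context {R : realType} {n : nat -> nat}.
Implicit Types (r : nat -> nat).

Lemma eq_left_part r (Y Z : cores R n r) k :
  (forall i j, (0 < i <= k)%N -> Y i j = Z i j) ->
  left_part Y k = left_part Z k.
Proof.
elim: k => //= k IHk YZ; congr right_unfolding; apply/boolp.funext => j.
by rewrite YZ ?leqnn // IHk // => i l /andP[i0 ik]; rewrite YZ // i0 leqW.
Qed.

Lemma eq_right_part r (Y Z : cores R n r) k m :
  (forall i j, (k < i <= k + m)%N -> Y i j = Z i j) ->
  right_part Y k m = right_part Z k m.
Proof.
elim: m k => //= m IHm k YZ; congr left_unfolding; apply/boolp.funext => j.
rewrite YZ ?leqnn ?addnS ?leq_addr // IHm // => i l /andP[ki im].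
by rewrite YZ // ltnW //= addnS -addSn.
Qed.

Lemma tt_row_left_part r (Y : cores R n r) k (j : forall l : 'I_k, 'I_(n l.+1))
    (N : 'I_(lsize n k)) : N = (\sum_(l < k) j l * lsize n l)%N :> nat ->
  tt_row Y j = row N (left_part Y k).
Proof.
elim: k j N => [|k IHk] j N eN /=; first by apply/rowP=> b; rewrite !mxE.
pose j' (l : 'I_k) := j (widen_ord (leqnSn k) l).
have -> : N = mxvec_index (j ord_max) (Ordinal (mixed_radix_ltn n k j')).
  by apply: ord_inj; rewrite mxvec_index_val eN big_ord_recr addnC.
rewrite (IHk j' (Ordinal (mixed_radix_ltn n k j'))) // -row_mul.
by apply/rowP=> b; rewrite [LHS]mxE [RHS]mxE right_unfoldingE.
Qed.

Lemma tt_left_part r d (Y : cores R n r) (j : midx d n) (N : 'I_(lsize n d)) :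
  linear_index j = N -> tt d Y j = \sum_b left_part Y d N b.
Proof.
move=> jN; rewrite ffunE; apply: eq_bigr => b _.
by rewrite (tt_row_left_part _ _ _ _ N) // mxE.
Qed.

(** Cutting a train after its k-th core is the associativity of the product of
    its slices. The induction moves core k+1 from the right part to the left one:
    the index of its mode is the lowest digit of q, and becomes the highest digit
    of p. *)
Lemma left_part_split r (Y : cores R n r) d k m (N : 'I_(lsize n d))
    (p : 'I_(lsize n k)) (q : 'I_(rsize n k m)) :
  d = (k + m)%N -> N = (q * lsize n k + p)%N :> nat ->
  \sum_b left_part Y d N b = (left_part Y k *m right_part Y k m) p q.
Proof.
elim: m k p q => [|m IHm] k p q.
  rewrite addn0 => dk; subst d; rewrite [q]ord1 => /val_inj ->.
  by rewrite mxE; apply: eq_bigr => b _; rewrite [const_mx _ _ _]mxE mulr1.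
case/mxvec_indexP: q => b j; rewrite mxvec_index_val addnS -addSn => dkm eN.
rewrite (IHm k.+1 (mxvec_index j p) b) //; last first.
  by rewrite eN mxvec_index_val /= mulnDl -mulnA addnA.
rewrite [LHS]mxE [RHS]mxE /=.
under eq_bigr do rewrite right_unfoldingE [X in X * _]mxE big_distrl /=.
rewrite exchange_big; apply: eq_bigr => a _.
rewrite left_unfoldingE [X in _ * X]mxE big_distrr /=.
by apply: eq_bigr => c _; rewrite mulrA.
Qed.

Lemma lsizeD k m : (lsize n (k + m) = rsize n k m * lsize n k)%N.
Proof.
elim: m k => [|m IHm] k; first by rewrite addn0 mul1n.
by rewrite addnS -addSn IHm /= mulnA.
Qed.

Lemma unfolding_tt r d (Y : cores R n r) i : (i <= d)%N ->
  unfolding (tt d Y) i = left_part Y i *m right_part Y i (d - i).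
Proof.
move=> id; apply/matrixP=> p q; rewrite mxE.
have ltN : (q * lsize n i + p < lsize n d)%N.
  have -> : lsize n d = (rsize n i (d - i) * lsize n i)%N.
    by rewrite -lsizeD subnKC.
  apply: leq_trans (_ : q.+1 * lsize n i <= _)%N.
    by rewrite mulSn addnC ltn_add2r.
  by rewrite leq_mul2r ltn_ord orbT.
have [idx_inv _ idxK] := linear_ord_bij d n.
case: pickP => [j /eqP jN | /(_ (idx_inv (Ordinal ltN)))]; last first.
  by rewrite [linear_index _](congr1 val (idxK (Ordinal ltN))) eqxx.
rewrite (tt_left_part _ _ _ _ (Ordinal ltN)) //.
by apply: left_part_split; rewrite ?subnKC.
Qed.

(** The trace against the all-ones matrix sums the entries of the Gram matrix;
    this is the shape from which [trace_gram] moves the cut inwards. *)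
Lemma inner_tt r r' d (Y : cores R n r) (Z : cores R n r') :
  inner (tt d Y) (tt d Z) =
  \tr (((left_part Y d)^T *m left_part Z d)^T *m const_mx 1).
Proof.
pose G := (left_part Y d)^T *m left_part Z d.
have -> : \tr (G^T *m const_mx 1) = \sum_b \sum_c G c b.
  rewrite /mxtrace; apply: eq_bigr => b _; rewrite mxE.
  by apply: eq_bigr => c _; rewrite !mxE mulr1.
have [idx_inv invK idxK] := linear_ord_bij d n.
rewrite /inner (reindex idx_inv) /=; last first.
  by exists (@linear_ord d n) => ? _; rewrite ?invK ?idxK.
transitivity (\sum_p \sum_b \sum_c left_part Y d p c * left_part Z d p b).
  apply: eq_bigr => p _.
  rewrite !(tt_left_part _ _ _ _ p) ?[linear_index _](congr1 val (idxK p)) //.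
  by rewrite big_distrr /=; apply: eq_bigr => b _; rewrite big_distrl.
rewrite exchange_big; apply: eq_bigr => b _.
rewrite exchange_big; apply: eq_bigr => c _.
by rewrite mxE; apply: eq_bigr => p _; rewrite mxE.
Qed.
End Train.

(** * Frobenius norms *)

Lemma const_mx1_id (R : nzRingType) m : m = 1%N -> const_mx 1 = 1%:M :> 'M[R]_m.
Proof. by move=> ->; apply/matrixP=> i j; rewrite !ord1 !mxE. Qed.

Lemma mul_const_mx1 (R : nzRingType) p m q : m = 1%N ->
  (const_mx 1 : 'M[R]_(p, m)) *m (const_mx 1 : 'M[R]_(m, q)) = const_mx 1.
Proof. by move=> ->; apply/matrixP=> i j; rewrite !mxE big_ord1 !mxE mulr1. Qed.

Lemma mxtrace_frobenius (R : comNzRingType) p q (M : 'M[R]_(p, q)) :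
  \tr (M *m M^T) = \sum_a \sum_b M a b ^+ 2.
Proof.
by apply: eq_bigr => a _; rewrite mxE; apply: eq_bigr => b _; rewrite mxE expr2.
Qed.

Lemma frobenius_ge0 (R : realDomainType) p q (M : 'M[R]_(p, q)) :
  0 <= \tr (M *m M^T).
Proof.
by rewrite mxtrace_frobenius; do 2!apply: sumr_ge0 => ? _; apply: sqr_ge0.
Qed.

Lemma frobenius_eq0 {R : realDomainType} {I : finType} {p q}
    {W : I -> 'M[R]_(p, q)} :
  \sum_i \tr (W i *m (W i)^T) = 0 -> forall i, W i = 0.
Proof.
move=> /eqP; rewrite psumr_eq0 => [/allP W0 i|i _]; last exact: frobenius_ge0.
have := W0 i (mem_index_enum i).
rewrite /= mxtrace_frobenius psumr_eq0 => [/allP Wi|a _]; last first.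
  by apply: sumr_ge0 => b _; apply: sqr_ge0.
apply/matrixP=> a b; have := Wi a (mem_index_enum a).
rewrite /= psumr_eq0 => [/allP/(_ b (mem_index_enum b))|c _]; last first.
  exact: sqr_ge0.
by rewrite /= sqrf_eq0 mxE => /eqP.
Qed.

(** * Inner products of trains *)

Section Gram.
Context {R : realType} {n : nat -> nat}.
Implicit Types (r : nat -> nat).

Lemma left_gramS r r' (Y : cores R n r) (Z : cores R n r') k :
  (left_part Y k.+1)^T *m left_part Z k.+1 =
  \sum_j (Y k.+1 j)^T *m ((left_part Y k)^T *m left_part Z k) *m Z k.+1 j.
Proof.
rewrite [LHS]right_unfolding_gram; apply: eq_bigr => j _.
by rewrite trmx_mul !mulmxA.
Qed.

Lemma right_gramS r r' (Y : cores R n r) (Z : cores R n r') k m :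
  right_part Y k m.+1 *m (right_part Z k m.+1)^T =
  \sum_j Y k.+1 j *m (right_part Y k.+1 m *m (right_part Z k.+1 m)^T)
           *m (Z k.+1 j)^T.
Proof.
rewrite [LHS]left_unfolding_gram; apply: eq_bigr => j _.
by rewrite trmx_mul !mulmxA.
Qed.

Lemma left_orthonormal r (Y : cores R n r) k : r 0%N = 1%N ->
  (forall i, (0 < i <= k)%N -> stiefel (right_unfolding (Y i))) ->
  (left_part Y k)^T *m left_part Y k = 1%:M.
Proof.
move=> r0; elim: k => [|k IHk] Yst.
  by rewrite /= trmx_const mul_const_mx1 // const_mx1_id.
rewrite left_gramS IHk => [|i /andP[i0 ik]]; last first.
  by apply: Yst; rewrite i0 leqW.
have := Yst k.+1; rewrite leqnn /= /stiefel right_unfolding_gram => <- //.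
by apply: eq_bigr => j _; rewrite mulmx1.
Qed.

Lemma right_orthonormal r (Y : cores R n r) d k m :
  (k + m)%N = d -> r d = 1%N ->
  (forall i, (k < i <= d)%N -> stiefel (left_unfolding (Y i))^T) ->
  right_part Y k m *m (right_part Y k m)^T = 1%:M.
Proof.
elim: m k => [|m IHm] k kd rd Yst.
  by rewrite /= trmx_const mul_const_mx1 // const_mx1_id // -(addn0 k) kd.
rewrite right_gramS (IHm k.+1) //; first last.
- by move=> i /andP[ki id]; apply: Yst; rewrite id ltnW.
- by rewrite addSn -addnS.
have := Yst k.+1; rewrite ltnSn -kd addnS ltnS leq_addr /= /stiefel trmxK.
by rewrite left_unfolding_gram => <- //; apply: eq_bigr => j _; rewrite mulmx1.
Qed.

(** The contraction of two trains can be carried out from both ends, meeting after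
    any core k: a core moves across the cut by cyclicity of the trace. *)
Lemma trace_gram r r' (Y : cores R n r) (Z : cores R n r') d k m :
  (k + m)%N = d ->
  \tr (((left_part Y d)^T *m left_part Z d)^T *m const_mx 1) =
  \tr (((left_part Y k)^T *m left_part Z k)^T *m
         (right_part Y k m *m (right_part Z k m)^T)).
Proof.
elim: m k => [|m IHm] k kd.
  by rewrite addn0 in kd; rewrite kd /= trmx_const mul_const_mx1.
rewrite (IHm k.+1) ?addSn -?addnS // left_gramS right_gramS.
rewrite linear_sum mulmx_suml mulmx_sumr !linear_sum /=; apply: eq_bigr => j _.
set G := _ *m left_part Z k; set H := right_part Y _ _ *m _.
rewrite [in RHS]mulmxA [RHS]mxtrace_mulC.
by rewrite (trmx_mul _ (Z _ _)) (trmx_mul _ G) trmxK !mulmxA.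
Qed.

(** The contraction of the train Y with all the cores X'_k, k < i, and X''_k,
    k > i: the image of tt d Y under the adjoint of the linear map
    W |-> X'_1 ... X'_(i-1) W X''_(i+1) ... X''_d. *)
Definition site_component {r r' : nat -> nat} d (X' X'' : cores R n r)
    (Y : cores R n r') (i : nat) : core R n r i := fun j =>
  (left_part X' i.-1)^T *m left_part Y i.-1 *m Y i j *m
    (right_part Y i (d - i) *m (right_part X'' i (d - i))^T).

Lemma left_part_train r (Y' Y Y'' : cores R n r) i k : (k < i)%N ->
  left_part (train Y' Y Y'' i) k = left_part Y' k.
Proof.
move=> ki; apply: eq_left_part => l j /andP[_ lk].
by rewrite /train (leq_ltn_trans lk ki).
Qed.

Lemma right_part_train r (Y' Y Y'' : cores R n r) i k m : (i <= k)%N ->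
  right_part (train Y' Y Y'' i) k m = right_part Y'' k m.
Proof.
move=> ik; apply: eq_right_part => l j /andP[kl _].
rewrite /train ltnNge (leq_trans ik (ltnW kl)) /=.
by rewrite gtn_eqF // (leq_ltn_trans ik kl).
Qed.

Lemma train_at r (Y' Y Y'' : cores R n r) i :
  (train Y' Y Y'' i : cores R n r) i = Y i.
Proof. by rewrite /train ltnn eqxx. Qed.

Lemma train_lt r (Y' Y Y'' : cores R n r) i k : (k < i)%N ->
  (train Y' Y Y'' i : cores R n r) k = Y' k.
Proof. by rewrite /train => ->. Qed.

Lemma train_gt r (Y' Y Y'' : cores R n r) i k : (i < k)%N ->
  (train Y' Y Y'' i : cores R n r) k = Y'' k.
Proof. by move=> ik; rewrite /train ltnNge ltnW //= gtn_eqF. Qed.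

Lemma inner_tt_train r r' d (X' W X'' : cores R n r) (Y : cores R n r') i :
  (0 < i <= d)%N ->
  inner (tt d Y) (tt d (train X' W X'' i)) =
  \sum_j \tr (site_component d X' X'' Y i j *m (W i j)^T).
Proof.
case: i => // i /= id.
rewrite inner_tt (trace_gram _ _ Y _ d i (d - i.+1).+1); last first.
  by rewrite addnS -addSn subnKC.
rewrite right_gramS left_part_train // mulmx_sumr linear_sum.
apply: eq_bigr => j _ /=; rewrite train_at right_part_train // trmx_mul trmxK.
by rewrite /site_component /= !mulmxA.
Qed.

(** Being the image under an adjoint, the component depends only on the tensor
    represented by the train; the cores and the ranks may differ. *)
Lemma eq_site_component {r r1 r2 d} {X' X'' : cores R n r} {Y : cores R n r1}
    (Z : cores R n r2) {i} j : (0 < i <= d)%N -> tt d Y = tt d Z ->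
  site_component d X' X'' Y i j = site_component d X' X'' Z i j.
Proof.
move=> id YZ; pose W : cores R n r := fun k l =>
  site_component d X' X'' Y k l - site_component d X' X'' Z k l.
apply/eqP; rewrite -subr_eq0; apply/eqP; apply: (@frobenius_eq0 _ _ _ _ (W i)).
under eq_bigr do rewrite {1}/W mulmxBl linearB /=.
by rewrite sumrB -!inner_tt_train // YZ subrr.
Qed.

(** Induction step for comparing two trains up to matrices S and T standing to
    the right of the last core. *)
Lemma eq_left_part_mul r r' (Y : cores R n r) (Z : cores R n r') k p
    (S : 'M[R]_(r k.+1, p)) (T : 'M[R]_(r' k.+1, p)) :
  (forall j, left_part Y k *m Y k.+1 j *m S = left_part Z k *m Z k.+1 j *m T) ->
  left_part Y k.+1 *m S = left_part Z k.+1 *m T.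
Proof.
move=> YZ; rewrite -!right_unfolding_mulr; congr right_unfolding.
exact: boolp.funext.
Qed.

End Gram.

(** * Orthogonalized factors *)

Section Orthogonalized.
Context {R : realType} {d : nat} {n r : nat -> nat}.
Context {X : tensor R d n} {X' X'' Xd : cores R n r}.
Hypotheses (r0 : r 0%N = 1%N) (rd : r d = 1%N).
Hypothesis orthX : orthogonalized_factors X X' X'' Xd.

Let Q := Qmx X' Xd.

Lemma orth_left k : (k < d)%N -> (left_part X' k)^T *m left_part X' k = 1%:M.
Proof.
have [st _ _] := orthX; move=> kd; apply: left_orthonormal => // i /andP[i0 ik].
by apply: st; rewrite i0 (leq_ltn_trans ik kd).
Qed.

Lemma orth_right k : (0 < k <= d)%N ->
  right_part X'' k (d - k) *m (right_part X'' k (d - k))^T = 1%:M.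
Proof.
have [_ st _] := orthX; move=> /andP[k0 kd].
apply: (right_orthonormal _ _ d) => //; first by rewrite subnKC.
by move=> i /andP[ki id]; apply: st; rewrite id (leq_ltn_trans k0 ki).
Qed.

Lemma orth_left_core i : (0 < i < d)%N -> \sum_j (X' i j)^T *m X' i j = 1%:M.
Proof.
by have [st _ _] := orthX; move=> /st; rewrite /stiefel right_unfolding_gram.
Qed.

Lemma orth_right_core i : (1 < i <= d)%N ->
  \sum_j X'' i j *m (X'' i j)^T = 1%:M.
Proof.
have [_ st _] := orthX; move=> /st.
by rewrite /stiefel trmxK left_unfolding_gram.
Qed.

Lemma QmxE i : Q i = \sum_j (X' i j)^T *m Xd i j.
Proof. exact: right_unfolding_gram. Qed.

Lemma site_component_center i j : (0 < i <= d)%N ->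
  site_component d X' X'' (train X' Xd X'' i) i j = Xd i j.
Proof.
case: i j => // i j /= id.
rewrite /site_component /= train_at left_part_train //.
by rewrite right_part_train // orth_left // orth_right // mul1mx mulmx1.
Qed.

(** The i-th component of X can be read off from its trains centered at i and at
    i+1. The first gives Xd_i. The second has core X'_i at site i, so that it gives
    X'_i M for some matrix M, which must be Q_i by orthonormality of X'_i. *)
Lemma center_left_factor i j : (0 < i < d)%N -> Xd i j = X' i j *m Q i.
Proof.
move=> i0d; have [i0 id] := andP i0d.
have id1 : (0 < i <= d)%N by rewrite i0 ltnW.
have [_ _ Xtt] := orthX.
have eX : tt d (train X' Xd X'' i) = tt d (train X' Xd X'' i.+1).
  by rewrite -(Xtt i) // -(Xtt i.+1).
pose M := right_part (train X' Xd X'' i.+1) i (d - i)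
            *m (right_part X'' i (d - i))^T.
have XdM k : Xd i k = X' i k *m M.
  rewrite -site_component_center //.
  rewrite (eq_site_component _ _ id1 eX).
  rewrite /site_component train_lt // left_part_train ?orth_left ?mul1mx //.
  + exact: leq_ltn_trans (leq_pred i) id.
  + by rewrite (leq_ltn_trans (leq_pred i)).
rewrite XdM; congr (_ *m _); rewrite QmxE; under eq_bigr do rewrite XdM mulmxA.
by rewrite -mulmx_suml orth_left_core // mul1mx.
Qed.

(** Same comparison at site i+1: to the left of this site, the contraction of the
    train centered at i with the cores X' is (X'_i)^(R,T) Xd_i^R = Q_i. *)
Lemma center_right_factor i j : (0 < i < d)%N -> Xd i.+1 j = Q i *m X'' i.+1 j.
Proof.
move=> i0d; have [i0 id] := andP i0d.
have id1 : (0 < i <= d)%N by rewrite i0 ltnW.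
have [_ _ Xtt] := orthX.
have eX : tt d (train X' Xd X'' i.+1) = tt d (train X' Xd X'' i).
  by rewrite -(Xtt i) // -(Xtt i.+1).
rewrite -site_component_center // (eq_site_component _ _ _ eX) // {eX}.
rewrite /site_component train_gt // right_part_train ?orth_right ?mulmx1 //.
congr (_ *m _); case: i i0 {i0d j} id id1 => // i _ id id1.
rewrite QmxE /= right_unfolding_gram; apply: eq_bigr => j _.
rewrite train_at left_part_train // trmx_mul -mulmxA [in X in _ *m X]mulmxA.
by rewrite orth_left ?mul1mx // ltnW.
Qed.

(** Q_i is a factor of the unfolding X^<i>, so that r_i = rank X^<i> <= rank Q_i. *)
Lemma Qmx_unit i : has_tt_rank r X -> (0 < i < d)%N -> Q i \in unitmx.
Proof.
move=> rkX i0d; have [i0 id] := andP i0d.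
have [_ _ Xtt] := orthX.
have left_train : left_part (train X' Xd X'' i) i = left_part X' i *m Q i.
  case: i i0 i0d id => // i _ i0d id /=; rewrite -right_unfolding_mulr.
  congr right_unfolding; apply: boolp.funext => j.
  by rewrite train_at left_part_train // center_left_factor // mulmxA.
rewrite -row_free_unit /row_free eqn_leq rank_leq_row -{1}(rkX i) //.
have id1 : (0 < i <= d)%N by rewrite i0 ltnW.
rewrite (Xtt i id1) (unfolding_tt _ _ _ _ (ltnW id)) left_train.
by rewrite (leq_trans (mxrankM_maxl _ _)) // mxrankM_maxr.
Qed.

End Orthogonalized.

(** * Stationary points *)

Section Stationary.
Context {R : realType} {d : nat} {n r r' : nat -> nat}.
Context {X A : tensor R d n}.
Context {X' X'' Xd : cores R n r} {A' A'' Ad : cores R n r'}.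
Hypotheses (r0 : r 0%N = 1%N) (rd : r d = 1%N).
Hypotheses (r'0 : r' 0%N = 1%N) (r'd : r' d = 1%N).
Hypothesis orthX : orthogonalized_factors X X' X'' Xd.
Hypothesis orthA : orthogonalized_factors A A' A'' Ad.

Let Q := Qmx X' Xd.
Let Q' := Qmx A' Ad.
Let B := Bmx X' A'.
Let C := Cmx d X'' A''.

Lemma trBmxE i : (B i)^T = (left_part X' i.-1)^T *m left_part A' i.-1.
Proof. exact: trmxK. Qed.

Lemma trBmx1 : (B 1)^T = const_mx 1.
Proof. by rewrite trBmxE trmx_const mul_const_mx1. Qed.

Lemma Cmx_d : C d = const_mx 1.
Proof. by rewrite /C /Cmx subnn /= trmx_const mul_const_mx1. Qed.

Lemma trBmxS i : (0 < i)%N ->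
  (B i.+1)^T = \sum_j (X' i j)^T *m (B i)^T *m A' i j.
Proof. by case: i => // i _; rewrite !trBmxE left_gramS. Qed.

Lemma Cmx_pred i : (0 < i <= d)%N ->
  C i.-1 = \sum_j A'' i j *m C i *m (X'' i j)^T.
Proof.
case: i => // i /= id; rewrite /C /Cmx.
by have -> : (d - i = (d - i.+1).+1)%N; [rewrite -subSn | exact: right_gramS].
Qed.

Lemma site_component_other i j : (0 < i <= d)%N ->
  site_component d X' X'' (train A' Ad A'' i) i j = (B i)^T *m Ad i j *m C i.
Proof.
case: i j => // i j /= id.
rewrite /site_component /= train_at left_part_train //.
by rewrite right_part_train // trmxK.
Qed.

(** Z_i is the residual of the equation to be proved at site i. *)
Let Z : cores R n r := fun i j => Xd i j - (B i)^T *m Ad i j *m C i.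

Lemma inner_residual (W : cores R n r) i : (0 < i <= d)%N ->
  inner (X - A) (tt d (train X' W X'' i)) = \sum_j \tr (Z i j *m (W i j)^T).
Proof.
move=> id; have [_ _ Xtt] := orthX; have [_ _ Att] := orthA.
pose V := tt d (train X' W X'' i).
transitivity (inner X V - inner A V); rewrite /V {V}.
  by rewrite /inner -sumrB; apply: eq_bigr => j _; rewrite !ffunE mulrBl.
rewrite {1}(Xtt i id) {1}(Att i id) !inner_tt_train // -sumrB.
apply: eq_bigr => j _; rewrite (site_component_center r0 rd orthX) //.
by rewrite site_component_other // mulmxBl linearB.
Qed.

Hypothesis stat : forall V, tangent_space X' X'' V -> inner (X - A) V = 0.

(** The test vector is the tangent vector with cores W_k equal to the residuals
    Z_k made gauge-admissible, i.e. projected onto the orthogonal complement of the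
    column space of X'_k when k < d. Since W_k is a projection of Z_k, the pairing
    of X - A with it is the sum of all squared norms of the W_k, which therefore
    all vanish. *)
Lemma residual_left_range i : (0 < i <= d)%N ->
  forall j, Z i j = if (i < d)%N
    then X' i j *m (Q i - (B i.+1)^T *m Q' i *m C i) else 0.
Proof.
pose G k := \sum_j (X' k j)^T *m Z k j.
pose W : cores R n r := fun k j =>
  Z k j - if (k < d)%N then X' k j *m G k else 0.
have XW k : (0 < k < d)%N -> \sum_j (X' k j)^T *m W k j = 0.
  move=> kd; have [_ lt_kd] := andP kd; rewrite /W lt_kd.
  under eq_bigr do rewrite mulmxBr mulmxA.
  by rewrite sumrB -mulmx_suml (orth_left_core orthX) // mul1mx subrr.
have ZW k : (0 < k <= d)%N ->
    \sum_j \tr (Z k j *m (W k j)^T) = \sum_j \tr (W k j *m (W k j)^T).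
  move=> /andP[k0 _]; apply/eqP; rewrite -subr_eq0 -sumrB; apply/eqP.
  under eq_bigr do rewrite -linearB -mulmxBl {1}/W subKr /=.
  case: ltnP => kd; last first.
    by under eq_bigr do rewrite mul0mx linear0; rewrite big1.
  under eq_bigr do rewrite mxtrace_mulC mulmxA.
  rewrite -linear_sum -mulmx_suml /=.
  have -> : \sum_j (W k j)^T *m X' k j = (\sum_j (X' k j)^T *m W k j)^T.
    by rewrite linear_sum /=; apply: eq_bigr => j _; rewrite trmx_mul trmxK.
  by rewrite XW ?k0 // trmx0 mul0mx linear0.
pose V : tensor R d n := \sum_(1 <= k < d.+1) tt d (train X' W X'' k).
have TV : tangent_space X' X'' V.
  exists W => // k kd; apply: trmx_inj.
  by rewrite trmx_mul [X in _ *m X]trmxK right_unfolding_gram XW // trmx0.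
have : inner (X - A) V = \sum_(1 <= k < d.+1) \sum_j \tr (W k j *m (W k j)^T).
  rewrite /inner; under eq_bigr do rewrite /V sum_ffunE big_distrr /=.
  rewrite exchange_big; apply: eq_big_nat => k kd.
  by rewrite -ZW // -inner_residual.
rewrite (stat _ TV) => /esym/eqP; rewrite psumr_eq0; last first.
  by move=> k _; apply: sumr_ge0 => j _; apply: frobenius_ge0.
move=> /allP W0 id j; have [i0 led] := andP id.
have /= := W0 i; rewrite mem_index_iota => /(_ id) /eqP/frobenius_eq0/(_ j).
move/eqP; rewrite subr_eq0 => /eqP ->; case: ltnP => // ltd; congr (_ *m _).
have i0d : (0 < i < d)%N by rewrite i0.
rewrite /G; under eq_bigr do rewrite mulmxBr.
rewrite sumrB -QmxE (trBmxS i) // !mulmx_suml; congr (_ - _).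
apply: eq_bigr => k _.
by rewrite (center_left_factor r'0 r'd orthA) // !mulmxA.
Qed.

(** Multiply Xd_(i+1) = Q_i X''_(i+1) and
    B_(i+1)^T Ad_(i+1) C_(i+1) = B_(i+1)^T Q'_i A''_(i+1) C_(i+1) by X''_(i+1)^T: the
    sum over the slices gives Q_i and B_(i+1)^T Q'_i C_i respectively. *)
Lemma Qmx_of_residual0 i : (0 < i < d)%N -> (forall j, Z i.+1 j = 0) ->
  Q i = (B i.+1)^T *m Q' i *m C i.
Proof.
move=> i0d Z0; have [i0 id] := andP i0d.
rewrite -[Q i]mulmx1 -(orth_right_core orthX i.+1) ?ltnS ?i0 //.
rewrite (Cmx_pred i.+1) //.
rewrite !mulmx_sumr; apply: eq_bigr => j _.
rewrite mulmxA -(center_right_factor r0 rd orthX) //.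
have /eqP := Z0 j; rewrite subr_eq0 => /eqP ->.
by rewrite (center_right_factor r'0 r'd orthA) // !mulmxA.
Qed.

Lemma residual0 i : (0 < i <= d)%N -> forall j, Z i j = 0.
Proof.
move=> /andP[i0 id]; rewrite -(subKn id).
have : (d - i < d)%N by rewrite ltn_subrL i0 (leq_trans i0).
elim: (d - i)%N => [|m IHm] md j.
  rewrite residual_left_range; last by rewrite subn0 leqnn (leq_trans i0 id).
  by have -> : (d - 0 < d)%N = false by rewrite subn0 ltnn.
have dm : (d - m = (d - m.+1).+1)%N by rewrite -subSn // ltnW.
have dm0 : (0 < d - m.+1 < d)%N.
  by rewrite subn_gt0 md ltn_subrL (leq_trans i0 id).
have [dm1 dm2] := andP dm0; rewrite residual_left_range ?dm1 ?leq_subr // dm2.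
rewrite -Qmx_of_residual0 ?subrr ?mulmx0 // => k.
by move: k; rewrite -dm; apply: IHm; rewrite ltnW.
Qed.

Lemma centerE i : (0 < i <= d)%N -> forall j, Xd i j = (B i)^T *m Ad i j *m C i.
Proof.
by move=> id j; apply/eqP; rewrite -subr_eq0; apply/eqP; apply: residual0.
Qed.

Lemma Qmx_factor i : (0 < i < d)%N -> Q i = (B i.+1)^T *m Q' i *m C i.
Proof.
move=> i0d; have [i0 id] := andP i0d.
by apply: Qmx_of_residual0 => // j; apply: residual0.
Qed.

Hypothesis rkX : has_tt_rank r X.

Let QU i : (0 < i < d)%N -> Q i \in unitmx.
Proof. exact: (Qmx_unit r0 rd orthX). Qed.

Lemma left_factorE i : (0 < i < d)%N -> forall j,
  X' i j = (B i)^T *m A' i j *m (Q' i *m C i *m invmx (Q i)).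
Proof.
move=> i0d j; have [i0 id] := andP i0d.
have id1 : (0 < i <= d)%N by rewrite i0 ltnW.
transitivity (Xd i j *m invmx (Q i)).
  by rewrite (center_left_factor r0 rd orthX _ j i0d) mulmxK // QU.
by rewrite (centerE _ id1) (center_left_factor r'0 r'd orthA _ j i0d) !mulmxA.
Qed.

Lemma right_factorE i : (1 < i <= d)%N -> forall j,
  X'' i j = (invmx (Q i.-1) *m (B i)^T *m Q' i.-1) *m A'' i j *m C i.
Proof.
case: i => // i i0d j; rewrite ltnS in i0d; have [i0 id] := andP i0d.
transitivity (invmx (Q i) *m Xd i.+1 j).
  by rewrite (center_right_factor r0 rd orthX _ j i0d) mulKmx // QU.
by rewrite (centerE i.+1) // (center_right_factor r'0 r'd orthA _ j i0d) !mulmxA.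
Qed.

Lemma Qmx_cancelr i : (0 < i < d)%N ->
  (B i.+1)^T *m Q' i *m C i *m invmx (Q i) = 1%:M.
Proof. by move=> i0d; rewrite -Qmx_factor // mulmxV // QU. Qed.

Lemma Qmx_cancell i : (0 < i < d)%N ->
  invmx (Q i) *m (B i.+1)^T *m Q' i *m C i = 1%:M.
Proof.
move=> i0d; rewrite -2!mulmxA [X in _ *m X]mulmxA -Qmx_factor //.
by rewrite mulVmx // QU.
Qed.

(** At the first site B_1 is the 1 x 1 identity, so that X'_1 is A'_1 times a
    matrix, and B_2 = A'_1^(R,T) X'_1^R is this matrix. *)
Lemma Bmx2E : (1 < d)%N -> B 2 = Q' 1%N *m C 1%N *m invmx (Q 1%N).
Proof.
move=> d1; apply: trmx_inj; rewrite trBmxS // trBmx1.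
apply: trmx_inj; rewrite trmxK linear_sum /=.
transitivity (\sum_j (A' 1%N j)^T *m A' 1%N j
                *m (Q' 1%N *m C 1%N *m invmx (Q 1%N))).
  apply: eq_bigr => j _; rewrite trmx_mul trmx_mul trmxK left_factorE //.
  rewrite trBmx1 trmx_const.
  rewrite -[X in _ *m (_ *m X)]mulmxA [X in _ *m X]mulmxA mul_const_mx1 //.
  rewrite (const_mx1_id _ (r' 0)) //.
  by rewrite mul1mx [LHS]mulmxA.
by rewrite -mulmx_suml (orth_left_core orthA) // mul1mx.
Qed.

(** Mirror image of [Bmx2E], at the last site. *)
Lemma Cmx_lastE : (1 < d)%N -> C d.-1 = (invmx (Q d.-1) *m (B d)^T *m Q' d.-1)^T.
Proof.
move=> d1; rewrite Cmx_pred ?leqnn ?(ltnW d1) // Cmx_d.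
transitivity (\sum_j A'' d j *m (A'' d j)^T
                *m (invmx (Q d.-1) *m (B d)^T *m Q' d.-1)^T).
  apply: eq_bigr => j _; rewrite right_factorE ?d1 ?leqnn // Cmx_d.
  rewrite trmx_mul [in LHS]trmx_mul trmx_const !mulmxA; congr (_ *m _ *m _).
  by rewrite -[LHS]mulmxA mul_const_mx1 // (const_mx1_id _ (r' d)) // mulmx1.
by rewrite -mulmx_suml (orth_right_core orthA) ?d1 ?leqnn // mul1mx.
Qed.

Let D i : 'M[R]_(r' i) := C i *m invmx (Q i) *m (B i.+1)^T *m Q' i.
Let E i : 'M[R]_(r' i) := Q' i *m C i *m invmx (Q i) *m (B i.+1)^T.

(** To the left of site i, X'_k B_(k+1)^T = B_k^T A'_k E_k; to the right of it,
    C_(k-1) X''_k = D_(k-1) A''_k C_k; and Xd_i = B_i^T Ad_i C_i at site i. So the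
    partial products of the two trains are related by B_(k+1)^T for k < i and by
    C_k for k >= i, and C_d is the 1 x 1 identity. *)
Lemma reconstruction i : (0 < i <= d)%N ->
  X = tt d (train (fun k j => A' k j *m E k) Ad
                  (fun k j => D k.-1 *m A'' k j) i).
Proof.
move=> i0d; have [i0 id] := andP i0d; have [_ _ Xtt] := orthX.
set Y := train _ _ _ i; pose T := train X' Xd X'' i; rewrite (Xtt i i0d) -/T.
have pre k : (k < i)%N -> left_part T k *m (B k.+1)^T = left_part Y k *m 1%:M.
  elim: k => [|k IHk] ki; first by rewrite trBmx1 mulmx1 /= mul_const_mx1.
  have {}IHk := IHk (ltnW ki); rewrite mulmx1 in IHk.
  have kd : (0 < k.+1 < d)%N by rewrite (leq_trans ki).
  apply: eq_left_part_mul => j; rewrite mulmx1 /Y /T !train_lt // -/Y -/T -IHk.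
  by rewrite left_factorE // /E !mulmxA.
have post k : (i <= k <= d)%N -> left_part T k *m 1%:M = left_part Y k *m C k.
  elim: k => [|k IHk] /andP[ik kd]; first by rewrite leqn0 (gtn_eqF i0) in ik.
  apply: eq_left_part_mul => j; rewrite mulmx1.
  have [ek | ik'] := eqVneq i k.+1.
    have lt_ki : (k < i)%N by rewrite ek.
    have Tk : (T : cores R n r) k.+1 j = Xd k.+1 j by rewrite /T ek train_at.
    have Yk : (Y : cores R n r') k.+1 j = Ad k.+1 j by rewrite /Y ek train_at.
    rewrite Tk Yk centerE // mulmxA [X in X *m _ = _]mulmxA (pre k lt_ki).
    by rewrite mulmx1.
  have {ik ik'} ik : (i <= k)%N by rewrite -ltnS ltn_neqAle ik' ik.
  have k1d : (1 < k.+1 <= d)%N by rewrite ltnS (leq_trans i0 ik).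
  have k0d : (0 < k < d)%N by rewrite (leq_trans i0 ik).
  have Tk : (T : cores R n r) k.+1 j = X'' k.+1 j by rewrite /T train_gt.
  have Yk : (Y : cores R n r') k.+1 j = D k *m A'' k.+1 j.
    by rewrite /Y train_gt.
  have {}IHk := IHk (introT andP (conj ik (ltnW kd))); rewrite mulmx1 in IHk.
  by rewrite Tk Yk IHk right_factorE // /D !mulmxA.
have := post d; rewrite id leqnn mulmx1 Cmx_d => /(_ isT) TY.
apply/ffunP=> j; rewrite !(tt_left_part _ _ _ _ (linear_ord j)) // TY.
under eq_bigr do rewrite mxE; rewrite exchange_big; apply: eq_bigr => b _.
under eq_bigr do rewrite [const_mx _ _ _]mxE mulr1.
by rewrite sumr_const card_ord rd.
Qed.
End Stationary.

(** * The comparison of orthogonalized factors *)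

(** Along a coordinate line the objective is a polynomial of degree 2 in the
    parameter, whose linear coefficient is the entry of X - A. *)
Lemma gradient_half_sqdist (R : realType) d n (A X : tensor R d n) :
  gradient (half_sqdist A) X = X - A.
Proof.
apply/ffunP=> j; rewrite !ffunE.
have inner_ge0 (Z : tensor R d n) : 0 <= inner Z Z.
  by apply: sumr_ge0 => k _; rewrite -expr2 sqr_ge0.
have lineE t : half_sqdist A (line X j t) =
    half_sqdist A X + (X j - A j) * t + 2^-1 * t ^+ 2.
  rewrite /half_sqdist /tnorm !sqr_sqrtr // /inner.
  rewrite (bigD1 j) //= [in RHS](bigD1 j) //=.
  rewrite (eq_bigr (fun k => (X - A) k * (X - A) k)); last first.
    by move=> k /negbTE kj; rewrite !ffunE kj mulr0 addr0.
  rewrite !ffunE eqxx mulr1; set s := \sum_(_ | _) _; by field.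
pose p := (half_sqdist A X)%:P + (X j - A j) *: 'X + 2^-1 *: 'X^2.
rewrite (_ : (fun _ => _) = horner p); rewrite /p {p}.
  rewrite derive1E derive_val !poly.derivE. 
  by rewrite !hornerE /= mulr0 mul0r addr0.
by apply: boolp.funext => t; rewrite lineE !hornerE.
Qed.

Theorem theorem3p2 (R : realType) (d : nat) (n r r' : nat -> nat)
  (X A : tensor R d n)
  (X' X'' Xd : cores R n r) (A' A'' Ad : cores R n r')
  (P : tensor R d n -> tensor R d n) :
  (2 <= d)%N ->
  r 0%N = 1%N -> r d = 1%N -> r' 0%N = 1%N -> r' d = 1%N ->
  has_tt_rank r X -> has_tt_rank r' A ->
  orthogonalized_factors X X' X'' Xd ->
  orthogonalized_factors A A' A'' Ad ->
  is_orthogonal_projection (@tangent_space R n r d X' X'') P ->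
  P (gradient (half_sqdist A) X) = 0 ->
  let Q := Qmx X' Xd in
  let Q' := Qmx A' Ad in
  let B := Bmx X' A' in
  let C := Cmx d X'' A'' in
  let D i : 'M[R]_(r' i) := C i *m invmx (Q i) *m (B i.+1)^T *m Q' i in
  let E i : 'M[R]_(r' i) := Q' i *m C i *m invmx (Q i) *m (B i.+1)^T in
  (forall i, (0 < i < d)%N -> Q i \in unitmx /\ Q' i \in unitmx) /\
  (forall i, (0 < i <= d)%N ->
     forall j, Xd i j = (B i)^T *m Ad i j *m C i) /\
  (forall i, (0 < i < d)%N ->
     forall j, X' i j = (B i)^T *m A' i j *m (Q' i *m C i *m invmx (Q i))) /\
  (forall i, (1 < i <= d)%N ->
     forall j, X'' i j =
       (invmx (Q i.-1) *m (B i)^T *m Q' i.-1) *m A'' i j *m C i) /\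
  (forall i, (0 < i <= d)%N ->
     X = tt d (train (fun k j => A' k j *m E k) Ad
                     (fun k j => D k.-1 *m A'' k j) i)) /\
  (B 2%N = Q' 1%N *m C 1%N *m invmx (Q 1%N) /\ stiefel (B 2%N)) /\
  (C d.-1 = (invmx (Q d.-1) *m (B d)^T *m Q' d.-1)^T /\ stiefel (C d.-1)) /\
  (forall i, (0 < i < d)%N ->
     [/\ eigenvalues_one_zero (D i) (r i),
         eigenvalues_one_zero (E i) (r i),
         (B i.+1)^T *m Q' i *m C i *m invmx (Q i) = 1%:M
       & invmx (Q i) *m (B i.+1)^T *m Q' i *m C i = 1%:M]) /\
  (forall i, (0 < i < d)%N -> forall k : 'I_(r i),
     [/\ right_eigenvector (D i) 1 (col k (C i *m invmx (Q i))),
         left_eigenvector (D i) 1 (row k ((B i.+1)^T *m Q' i)),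
         right_eigenvector (E i) 1 (col k (Q' i *m C i))
       & left_eigenvector (E i) 1 (row k (invmx (Q i) *m (B i.+1)^T))]).
Proof.
move=> d2 r0 rd r'0 r'd rkX rkA oX oA projP P0 Q Q' B C D E.
have stat V : tangent_space X' X'' V -> inner (X - A) V = 0.
  move=> TV; have [_ /(_ V TV)] := projP (gradient (half_sqdist A) X).
  by rewrite P0 subr0 gradient_half_sqdist.
have DE i : D i = (C i *m invmx (Q i)) *m ((B i.+1)^T *m Q' i).
  by rewrite /D -mulmxA.
have EE i : E i = (Q' i *m C i) *m (invmx (Q i) *m (B i.+1)^T).
  by rewrite /E -mulmxA.
have cancelr := Qmx_cancelr r0 rd r'0 r'd oX oA stat rkX.
have cancell := Qmx_cancell r0 rd r'0 r'd oX oA stat rkX.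
have VUD i : (0 < i < d)%N ->
    ((B i.+1)^T *m Q' i) *m (C i *m invmx (Q i)) = 1%:M.
  by move=> i0d; have := cancelr i i0d; rewrite -mulmxA.
have VUE i : (0 < i < d)%N ->
    (invmx (Q i) *m (B i.+1)^T) *m (Q' i *m C i) = 1%:M.
  by move=> i0d; have := cancell i i0d; rewrite -mulmxA.
have B2 : B 2%N = Q' 1%N *m C 1%N *m invmx (Q 1%N) :=
  Bmx2E r0 rd r'0 r'd oX oA stat rkX d2.
have Cd1 : C d.-1 = (invmx (Q d.-1) *m (B d)^T *m Q' d.-1)^T :=
  Cmx_lastE r0 rd r'0 r'd oX oA stat rkX d2.
split=> [i i0d|].
  by split; [exact: (Qmx_unit r0 rd oX) | exact: (Qmx_unit r'0 r'd oA)].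
split=> [i id|]; first exact: (centerE r0 rd r'0 r'd oX oA stat).
split=> [i id|]; first exact: (left_factorE r0 rd r'0 r'd oX oA stat rkX).
split=> [i id|]; first exact: (right_factorE r0 rd r'0 r'd oX oA stat rkX).
split=> [i id|]; first exact: (reconstruction r0 rd r'0 r'd oX oA stat rkX).
split.
  split=> //; rewrite /stiefel {2}B2 -(mulmxA (Q' 1%N)) (mulmxA (B 2%N)^T).
  by apply: VUD; rewrite d2.
split.
  split=> //; rewrite /stiefel {1}Cd1 trmxK.
  have cancell_pred e : (1 < e <= d)%N ->
      invmx (Q e.-1) *m (B e)^T *m Q' e.-1 *m C e.-1 = 1%:M.
    by case: e => // e ed; apply: cancell.
  by apply: cancell_pred; rewrite d2 leqnn.
split=> i i0d => [|k]; rewrite DE EE; split.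
- exact/eigenvalues_left_inverse/VUD.
- exact/eigenvalues_left_inverse/VUE.
- exact: cancelr.
- exact: cancell.
- exact/col_right_eigenvector/VUD.
- exact/row_left_eigenvector/VUD.
- exact/col_right_eigenvector/VUE.
- exact/row_left_eigenvector/VUE.
Qed.
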